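(* Let $N\ge1$ be an integer, $q=e^{2\pi i/N}$, and let $\alpha,\beta$ be real parameters with $|a_n|<1$ for all $n\ge 0$, where $a_n=-\frac{\alpha+1/2+(-1)^{n+1}(\beta+1/2)}{n+\alpha+\beta+2}$. Let $R_kf(z)=f(q^k/z)$, $T_kf(z)=f(q^kz)$, let $\mathcal I$ be the identity, and let $H(N)=L(N)^2-N(\alpha+\beta+1)L(N)$ be the operator of which the sieved Jacobi polynomials of the first kind $P_n(z+z^{-1};N)$ are eigenfunctions. Set $$C(z)=z\left(1+N(\alpha+\beta+1)+\frac{2N\left(\alpha+\beta+1+(\alpha-\beta)z^N\right)}{z^{2N}-1}\right)$$ and $A_k'(z;N)=\frac{d}{dz}A_k(z;N)$. Then $H(N)$ has the following two expressions, which are equivalent when acting on symmetric Laurent polynomials (those with $f(z)=f(1/z)$), in particular on the $P_n(z+z^{-1};N)$: $$H(N)=z^2\partial_z^2+C(z)\partial_z+z\sum_{k=0}^{N-1}A_k'(z;N)\,(R_k-\mathcal I),$$ $$H(N)=z^2\partial_z^2+C(z)\partial_z+z\sum_{k=1}^{N-1}A_k'(z;N)\,(T_{-k}-\mathcal I).$$ (The first holds as an identity of operators on all Laurent polynomials; the second as an identity of operators on symmetric Laurent polynomials.)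
   Context: The operator $L(N)$ acts on Laurent polynomials in $z$ by $$L(N)=z\partial_z+\sum_{k=0}^{N-1}A_k(z;N)(R_k-\mathcal I),$$ where for $N$ even $$A_k(z;N)=\sigma_k\frac{z^2}{q^k-z^2},\qquad \sigma_k=\alpha+\beta+1+(-1)^k(\alpha-\beta),$$ and for $N$ odd $$A_k(z;N)=\frac{(\alpha+\beta+1)z^2+\rho_k(\alpha-\beta)z}{q^k-z^2},\qquad \rho_k=\begin{cases}q^{k/2}, & k\ \text{even},\\ q^{(k-N)/2}, & k\ \text{odd}.\end{cases}$$ The sieved Jacobi polynomials of the first kind are defined as follows. Put $a_n(N)=a_{k-1}$ if $n=Nk-1$ for an integer $k\ge1$, and $a_n(N)=0$ for other $n\ge0$. Let $\Phi_0(z;N)=1$, $\Phi_{n+1}(z;N)=z\Phi_n(z;N)-a_n(N)z^n\Phi_n(z^{-1};N)$, and $\psi_{2n}(z;N)=z^n\Phi_{2n}(z^{-1};N)$, $\psi_{2n+1}(z;N)=z^{-n}\Phi_{2n+1}(z;N)$. Then $P_0=1$ and, for $n\ge1$, $P_n(z+z^{-1};N)=\psi_{2n}(z;N)+(1+a_{2n-1}(N))\psi_{2n-1}(z;N)$, which is a monic polynomial of degree $n$ in $z+z^{-1}$. Identities are understood as identities of rational functions of $z$. The condition $|a_n|<1$ for all $n\ge0$ is equivalent to $\alpha,\beta>-1$. *)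

(* Defs.v *)
From HB Require Import structures.
From mathcomp Require Import all_boot all_order all_algebra ring.
From mathcomp Require Import complex.
From mathcomp Require Import reals sequences exp trigo.

Set Implicit Arguments.
Unset Strict Implicit.
Unset Printing Implicit Defensive.

Import Order.TTheory GRing.Theory Num.Theory.
Local Open Scope ring_scope.
Local Open Scope complex_scope.

Local Notation "x %:F" := (tofrac x) (at level 1, format "x %:F") : ring_scope.

Section RationalFunctions.
Variable F : fieldType.
Local Notation K := {fraction {poly F}}.
Implicit Types (f g : K) (p n d : {poly F}) (c : F).

Definition ratC c : K := c%:P%:F.

(* The variable z of the rational functions. *)
Definition ratX : K := 'X%:F.

(* The derivative df/dz, by the quotient rule applied to the representative
   \n_(repr f) / \d_(repr f) of f; by rat_derE the value does not depend on the
   representative. *)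
Definition rat_der f : K :=
  let n := \n_(repr f) in let d := \d_(repr f) in
  (n^`() * d - n * d^`())%:F / (d ^+ 2)%:F.

Definition poly_subst p g : K := (map_poly ratC p).[g].

(* f(g(z)). By rat_substE the value does not depend on the representative of f
   when g is transcendental over F. Only g = c * z and g = c / z with c != 0
   are used below; see poly_subst_mulX_neq0 and poly_subst_divX_neq0. *)
Definition rat_subst f g : K :=
  poly_subst \n_(repr f) g / poly_subst \d_(repr f) g.

Definition laurent f : Prop := exists p (m : nat), f = p%:F / ratX ^+ m.

Definition symmetric_laurent f : Prop :=
  laurent f /\ rat_subst f ratX^-1 = f.

Lemma ratC_is_zmod_morphism : zmod_morphism ratC.
Proof. by move=> x y; rewrite /ratC polyCB tofracB. Qed.

Lemma ratC_is_monoid_morphism : monoid_morphism ratC.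
Proof. by split=> [|x y]; rewrite /ratC ?tofrac1 // polyCM tofracM. Qed.

HB.instance Definition _ :=
  GRing.isZmodMorphism.Build F K ratC ratC_is_zmod_morphism.
HB.instance Definition _ :=
  GRing.isMonoidMorphism.Build F K ratC ratC_is_monoid_morphism.

Lemma repr_fracE f : f = (\n_(repr f))%:F / (\d_(repr f))%:F.
Proof.
apply: (canRL (mulfK _)); first by rewrite tofrac_eq0 denom_ratioP.
rewrite -[X in X * _]reprK; move: (repr f) => r.
rewrite -[_ * _]/(FracField.mul _ _) !piE.
apply/eqP; rewrite FracField.equivf_def /FracField.equivf /FracField.mulf.
by rewrite !numden_Ratio ?mulf_neq0 ?oner_neq0 ?denom_ratioP // !mulr1 mulrC.
Qed.

Lemma repr_frac_cross n d : d != 0 ->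
  \n_(repr (n%:F / d%:F)) * d = n * \d_(repr (n%:F / d%:F)).
Proof.
move=> d0; apply/eqP; rewrite -tofrac_eq !tofracM.
by rewrite -eqr_div ?tofrac_eq0 ?denom_ratioP // -repr_fracE.
Qed.

Lemma rat_derE n d : d != 0 ->
  rat_der (n%:F / d%:F) = (n^`() * d - n * d^`())%:F / (d ^+ 2)%:F.
Proof.
move=> d0; rewrite /rat_der; have := repr_frac_cross n d0.
have := denom_ratioP (repr (n%:F / d%:F)).
set r := repr _; move: (\n_ r) (\d_ r) => n1 d1 d10 e.
have e' : n1^`() * d + n1 * d^`() = n^`() * d1 + n * d1^`().
  by rewrite -!derivM e.
apply/eqP; rewrite eqr_div ?tofrac_eq0 ?expf_neq0 // -!tofracM tofrac_eq.
rewrite -subr_eq0; apply/eqP.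
transitivity ((n1^`() * d + n1 * d^`() - (n^`() * d1 + n * d1^`())) * (d1 * d)
   - (n1 * d - n * d1) * (d1^`() * d + d^`() * d1)); first by ring.
by rewrite e' e !subrr !mul0r subrr.
Qed.

Lemma rat_substE n d g : (forall p, p != 0 -> poly_subst p g != 0) -> d != 0 ->
  rat_subst (n%:F / d%:F) g = poly_subst n g / poly_subst d g.
Proof.
move=> g0 d0; rewrite /rat_subst; have := repr_frac_cross n d0.
have := denom_ratioP (repr (n%:F / d%:F)).
set r := repr _; move: (\n_ r) (\d_ r) => n1 d1 d10 e.
apply/eqP; rewrite eqr_div ?g0 // /poly_subst -!hornerM -!rmorphM /=.
by rewrite e.
Qed.

Lemma poly_subst_mulX_neq0 c p : c != 0 -> p != 0 ->
  poly_subst p (ratC c * ratX) != 0.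
Proof.
move=> c0 p0.
have -> : poly_subst p (ratC c * ratX) = (p \Po (c%:P * 'X))%:F.
  rewrite /poly_subst -tofracM /comp_poly -horner_map /= -map_poly_comp /=.
  by congr (_.[_]); apply: eq_map_poly.
rewrite tofrac_eq0 comp_poly_eq0 // mul_polyC size_scale // size_polyX.
by [].
Qed.

Lemma poly_subst_divX_neq0 c p : c != 0 -> p != 0 ->
  poly_subst p (ratC c / ratX) != 0.
Proof.
move=> c0 p0; have z0 : ratX != 0 by rewrite tofrac_eq0 polyX_eq0.
pose m := (size p).-1.
have -> : poly_subst p (ratC c / ratX)
    = (\sum_(i < size p) (p`_i * c ^+ i) *: 'X^(m - i))%:F / ratX ^+ m.
  apply: (canRL (mulfK _)); first by rewrite expf_neq0.
  rewrite /poly_subst (@horner_coef_wide _ (size p)) ?size_map_poly // raddf_sum.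
  rewrite mulr_suml; apply: eq_bigr => i _.
  have le_im : (i <= m)%N by rewrite -ltnS prednK ?size_poly_gt0.
  rewrite coef_map /= -mul_polyC tofracM tofracXn.
  have -> : (p`_i * c ^+ i)%:P%:F = ratC p`_i * ratC c ^+ i.
    by rewrite -[LHS]/(ratC _) rmorphM rmorphXn.
  rewrite exprMn exprVn -!mulrA; congr (_ * (_ * _)).
  have -> : ratX ^+ m = ratX ^+ i * ratX ^+ (m - i) by rewrite -exprD subnKC.
  by rewrite mulKf ?expf_neq0.
apply: mulf_neq0; last by rewrite invr_eq0; apply: expf_neq0.
rewrite tofrac_eq0.
have lt_m : (m < size p)%N by rewrite prednK ?size_poly_gt0.
apply: contraNneq (p0) => /(congr1 (fun q : {poly F} => q`_0)) /=.
rewrite coef0 coef_sum (bigD1 (Ordinal lt_m)) //= coefZ subnn coefXn mulr1.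
rewrite big1 => [|i ne_im].
  rewrite addr0 => /eqP.
  by rewrite mulf_eq0 (negPf (expf_neq0 _ c0)) orbF -lead_coefE lead_coef_eq0.
have lt_im : (i < m)%N.
  rewrite ltn_neqAle; apply/andP; split; first exact: ne_im.
  by rewrite -ltnS prednK ?size_poly_gt0.
by rewrite coefZ coefXn eq_sym subn_eq0 leqNgt lt_im mulr0.
Qed.

End RationalFunctions.

Arguments ratX {F}.

Section SievedJacobi.
Variable R : realType.
Local Notation C := R[i].
Local Notation K := {fraction {poly C}}.
Local Notation z := (@ratX C).
Implicit Types (N k n : nat) (alpha beta : R) (f : K).

Definition cexp (w : C) : C :=
  (expR (complex.Re w))%:C * (cos (complex.Im w) +i* sin (complex.Im w)).

Definition rootq N : C := cexp (0 +i* (2 * pi / N%:R)).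

Definition ratR (x : R) : K := ratC x%:C.

Definition reflection N k f : K := rat_subst f (ratC (rootq N ^+ k) / z).

Definition rotation N (k : int) f : K := rat_subst f (ratC (rootq N ^ k) * z).

Definition jacobi_sigma alpha beta k : R :=
  alpha + beta + 1 + (-1) ^+ k * (alpha - beta).

(* Only used for N odd and k < N, where both exponents are integers. *)
Definition jacobi_rho N k : C :=
  if odd k then rootq N ^ ((k%:Z - N%:Z) %/ 2)%Z else rootq N ^ (k%:Z %/ 2)%Z.

Definition coefA alpha beta N k : K :=
  if odd N then
    (ratR (alpha + beta + 1) * z ^+ 2
      + ratC (jacobi_rho N k) * ratR (alpha - beta) * z)
    / (ratC (rootq N ^+ k) - z ^+ 2)
  else
    ratR (jacobi_sigma alpha beta k) * (z ^+ 2 / (ratC (rootq N ^+ k) - z ^+ 2)).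

Definition opL alpha beta N f : K :=
  z * rat_der f
  + \sum_(0 <= k < N) coefA alpha beta N k * (reflection N k f - f).

Definition opH alpha beta N f : K :=
  opL alpha beta N (opL alpha beta N f)
  - ratR (N%:R * (alpha + beta + 1)) * opL alpha beta N f.

Definition coefC alpha beta N : K :=
  z * (1 + ratR (N%:R * (alpha + beta + 1))
       + 2 * N%:R * (ratR (alpha + beta + 1) + ratR (alpha - beta) * z ^+ N)
         / (z ^+ (2 * N)%N - 1)).

Definition verblunsky alpha beta n : R :=
  - ((alpha + 2^-1 + (-1) ^+ n.+1 * (beta + 2^-1))
     / (n%:R + alpha + beta + 2)).

(* n = N k - 1 with k >= 1 means that N divides n + 1, and then
   k - 1 = (n + 1) / N - 1. *)
Definition sieved_verblunsky alpha beta N n : R :=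
  if (N %| n.+1)%N then verblunsky alpha beta (n.+1 %/ N).-1 else 0.

Fixpoint sieved_Phi alpha beta N n : K :=
  if n is m.+1 then
    z * sieved_Phi alpha beta N m
    - ratR (sieved_verblunsky alpha beta N m)
      * z ^+ m * rat_subst (sieved_Phi alpha beta N m) z^-1
  else 1.

Definition sieved_psi alpha beta N n : K :=
  if odd n then z ^- n./2 * sieved_Phi alpha beta N n
  else z ^+ n./2 * rat_subst (sieved_Phi alpha beta N n) z^-1.

(* The sieved Jacobi polynomial of the first kind P_n, evaluated at z + 1/z. *)
Definition sieved_jacobi alpha beta N n : K :=
  if n is m.+1 then
    sieved_psi alpha beta N (2 * n)%N
    + (1 + ratR (sieved_verblunsky alpha beta N (2 * m).+1%N))
      * sieved_psi alpha beta N (2 * m).+1%N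
  else 1.

Definition opH_reflections alpha beta N f : K :=
  z ^+ 2 * rat_der (rat_der f) + coefC alpha beta N * rat_der f
  + z * \sum_(0 <= k < N)
          rat_der (coefA alpha beta N k) * (reflection N k f - f).

Definition opH_rotations alpha beta N f : K :=
  z ^+ 2 * rat_der (rat_der f) + coefC alpha beta N * rat_der f
  + z * \sum_(1 <= k < N)
          rat_der (coefA alpha beta N k) * (rotation N (- k%:Z) f - f).

End SievedJacobi.

(* Main.v *)
Require Import Defs.
From HB Require Import structures.
From mathcomp Require Import all_boot all_order all_algebra ring lra zify.
From mathcomp Require Import complex reals sequences exp trigo.

Set Implicit Arguments.
Unset Strict Implicit.
Unset Printing Implicit Defensive.

Import Order.TTheory GRing.Theory Num.Theory.
Local Open Scope ring_scope.
Local Open Scope complex_scope.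

Local Notation "x %:F" := (tofrac x) (at level 1, format "x %:F") : ring_scope.

(** Let theta = z d/dz and E = sum_k A_k (R_k - I), so that L = theta + E. Since
    R_j theta = - theta R_j, the sum theta E + E theta equals
    sum_k theta(A_k) (R_k - I) - 2 S theta, where S = sum_k A_k. Moreover
    E^2 = N (alpha + beta + 1) E: this follows from
    S + R_k S = - N (alpha + beta + 1) and from the vanishing of
    sum_k A_k R_k(A_(k+m)) for m <> 0 mod N, because by partial fractions the
    k-th summand has the form W_k - W_(k-m). Hence H reduces to
    theta^2 - (2 S + N (alpha + beta + 1)) theta + sum_k theta(A_k) (R_k - I),
    and summing over the roots of unity, with Z = z^N,
    S = N ((alpha + beta + 1) Z^2 + (alpha - beta) Z) / (1 - Z^2). *)

(** * Field identities behind the rules of differentiation *)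

Section FieldIdentities.
Variable L : fieldType.
Implicit Types a b c d u v x y : L.

Lemma quotient_ruleM a a' b b' c c' d d' : b != 0 -> d != 0 ->
  ((a' * c + a * c') * (b * d) - a * c * (b' * d + b * d')) / (b * d) ^+ 2
  = (a' * b - a * b') / b ^+ 2 * (c / d) + a / b * ((c' * d - c * d') / d ^+ 2).
Proof. by move=> b0 d0; field; rewrite b0 d0. Qed.

Lemma quotient_ruleD a a' b b' c c' d d' : b != 0 -> d != 0 ->
  ((a' * d + a * d' + (c' * b + c * b')) * (b * d)
     - (a * d + c * b) * (b' * d + b * d')) / (b * d) ^+ 2
  = (a' * b - a * b') / b ^+ 2 + (c' * d - c * d') / d ^+ 2.
Proof. by move=> b0 d0; field; rewrite b0 d0. Qed.

(** Division step of the chain rule: [d] and [e] stand for a denominator and its derivative after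
    substitution, [w] for the derivative of the inner function. *)
Lemma leibniz_cancel x u y d e w : d != 0 ->
  x * d + y * (e * w) = (u * d + y * e) * w -> x = u * w.
Proof.
move=> d0 eq_xu; apply: (mulIf d0); apply: (addIr (y * (e * w))).
by rewrite eq_xu; ring.
Qed.

End FieldIdentities.

(** * Derivation and substitution on rational functions *)

Section RationalFunctions.
Variable F : fieldType.
Local Notation K := {fraction {poly F}}.
Local Notation z := (@ratX F).
Implicit Types (f g : K) (p n d : {poly F}) (c : F).

Lemma ratX_neq0 : z != 0.
Proof. by rewrite tofrac_eq0 polyX_eq0. Qed.

Lemma poly_subst_ratX p : poly_subst p z = p%:F.
Proof.
rewrite /poly_subst /ratX.
have -> : map_poly (@ratC F) p = map_poly (@tofrac {poly F}) (map_poly polyC p).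
  by rewrite -map_poly_comp; apply: eq_map_poly.
by rewrite horner_map /= -/(comp_poly 'X p) comp_polyXr.
Qed.

Lemma ratP f : exists n d, d != 0 /\ f = n%:F / d%:F.
Proof.
exists \n_(repr f), \d_(repr f).
by split; [apply: denom_ratioP|apply: repr_fracE].
Qed.

Lemma rat_der_tofrac p : rat_der p%:F = (p^`())%:F.
Proof.
rewrite -[p%:F]divr1 -tofrac1 rat_derE ?oner_neq0 //.
by rewrite expr1n tofrac1 divr1 mulr1 derivC mulr0 subr0.
Qed.

Lemma rat_derM f g : rat_der (f * g) = rat_der f * g + f * rat_der g.
Proof.
have [n [d [d0 ->]]] := ratP f; have [m [e [e0 ->]]] := ratP g.
rewrite mulf_div -!tofracM !rat_derE ?mulf_neq0 //.
rewrite !derivM !(tofracXn, tofracM, tofracB, tofracD).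
by apply: quotient_ruleM; rewrite tofrac_eq0.
Qed.

Lemma rat_derD f g : rat_der (f + g) = rat_der f + rat_der g.
Proof.
have [n [d [d0 ->]]] := ratP f; have [m [e [e0 ->]]] := ratP g.
rewrite addf_div ?tofrac_eq0 // -!tofracM -!tofracD !rat_derE ?mulf_neq0 //.
rewrite !(derivM, derivD) !(tofracXn, tofracM, tofracB, tofracD).
by apply: quotient_ruleD; rewrite tofrac_eq0.
Qed.

Lemma rat_derC c : rat_der (ratC c) = 0.
Proof. by rewrite rat_der_tofrac derivC tofrac0. Qed.

Lemma rat_derX : rat_der z = 1.
Proof. by rewrite rat_der_tofrac derivX tofrac1. Qed.

Definition transcendental g := forall p, p != 0 -> poly_subst p g != 0.

Lemma transcendental_divX c : c != 0 -> transcendental (ratC c / z).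
Proof. by move=> c0 p; apply: poly_subst_divX_neq0. Qed.

Section Substitution.
Variables (g : K) (tg : transcendental g).

(* The unused argument tg lets rat_eval carry a canonical morphism structure. *)
Definition rat_eval (tg : transcendental g) f : K := rat_subst f g.
Local Notation ev := (rat_eval tg).

Lemma poly_substD p n : poly_subst (p + n) g = poly_subst p g + poly_subst n g.
Proof. by rewrite /poly_subst rmorphD hornerD. Qed.

Lemma poly_substB p n : poly_subst (p - n) g = poly_subst p g - poly_subst n g.
Proof. by rewrite /poly_subst rmorphB hornerD hornerN. Qed.

Lemma poly_substM p n : poly_subst (p * n) g = poly_subst p g * poly_subst n g.
Proof. by rewrite /poly_subst rmorphM hornerM. Qed.

Lemma poly_substC c : poly_subst c%:P g = ratC c.
Proof. by rewrite /poly_subst map_polyC hornerC. Qed.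

Lemma poly_substX : poly_subst 'X g = g.
Proof. by rewrite /poly_subst map_polyX hornerX. Qed.

Lemma rat_subst_tofrac p : rat_subst p%:F g = poly_subst p g.
Proof.
rewrite -[p%:F]divr1 -tofrac1 (rat_substE _ tg) ?oner_neq0 //.
by rewrite -[1]/(1%:P) (poly_substC 1) rmorph1 divr1.
Qed.

Fact rat_eval_is_zmod_morphism : zmod_morphism ev.
Proof.
move=> x y; rewrite /rat_eval.
have [n [d [d0 ->]]] := ratP x; have [m [e [e0 ->]]] := ratP y.
rewrite -mulNr addf_div ?tofrac_eq0 // mulNr -!tofracM -tofracB.
rewrite !(rat_substE _ tg) ?mulf_neq0 // poly_substB !poly_substM.
by rewrite -[in RHS]mulNr addf_div ?tg // mulNr.
Qed.

Fact rat_eval_is_monoid_morphism : monoid_morphism ev.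
Proof.
rewrite /rat_eval; split=> [|x y].
  by rewrite -[1](rmorph1 (@ratC F)) rat_subst_tofrac poly_substC.
have [n [d [d0 ->]]] := ratP x; have [m [e [e0 ->]]] := ratP y.
rewrite mulf_div -!tofracM !(rat_substE _ tg) ?mulf_neq0 // !poly_substM.
by rewrite mulf_div.
Qed.

HB.instance Definition _ :=
  GRing.isZmodMorphism.Build K K ev rat_eval_is_zmod_morphism.
HB.instance Definition _ :=
  GRing.isMonoidMorphism.Build K K ev rat_eval_is_monoid_morphism.

Lemma rat_evalC c : ev (ratC c) = ratC c.
Proof. by rewrite /rat_eval rat_subst_tofrac poly_substC. Qed.

Lemma rat_evalX : ev z = g.
Proof. by rewrite /rat_eval rat_subst_tofrac poly_substX. Qed.

Lemma rat_der_poly_subst p :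
  rat_der (poly_subst p g) = poly_subst p^`() g * rat_der g.
Proof.
elim/poly_ind: p => [|p c IH].
  by rewrite deriv0 -[0]/(0%:P) !poly_substC rat_derC rmorph0 mul0r.
rewrite derivMXaddC !(poly_substD, poly_substM, poly_substX, poly_substC).
by rewrite rat_derD rat_derM rat_derC IH addr0 mulrDl addrC mulrAC.
Qed.

(** Chain rule. With [f * d = n] for polynomials, where the rule is known, differentiate this
    product before and after substitution and cancel the image of [d], nonzero because [g] is
    transcendental. *)
Lemma rat_der_eval f : rat_der (ev f) = ev (rat_der f) * rat_der g.
Proof.
have [n [d [d0 fE]]] := ratP f.
have fd : f * d%:F = n%:F by rewrite fE divfK ?tofrac_eq0.
have dfd : rat_der f * d%:F + f * (d^`())%:F = (n^`())%:F.
  by rewrite -!rat_der_tofrac -rat_derM fd.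
have evp p : ev p%:F = poly_subst p g by rewrite /rat_eval rat_subst_tofrac.
have efd : ev f * poly_subst d g = poly_subst n g by rewrite -!evp -rmorphM fd.
move: (rat_der f) dfd => f' /(congr1 ev).
rewrite rmorphD !rmorphM /= !evp => edfd.
apply: (leibniz_cancel (y := ev f) (e := poly_subst d^`() g) (tg d0)).
by rewrite edfd -[RHS]rat_der_poly_subst -efd rat_derM rat_der_poly_subst.
Qed.

End Substitution.

(** The constants and z generate the field, so a morphism fixing the constants is determined by its
    value at z. This identifies composites of substitutions. *)
Lemma rmorph_rat_subst (phi : {rmorphism K -> K}) f :
  (forall c, phi (ratC c) = ratC c) -> phi f = rat_subst f (phi z).
Proof.
move=> phiC.
have phip p : phi p%:F = poly_subst p (phi z).
  rewrite -[p%:F]poly_subst_ratX /poly_subst -horner_map -map_poly_comp /=.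
  by congr (_.[_]); apply: eq_map_poly => c /=.
by rewrite /rat_subst -!phip -fmorph_div -repr_fracE.
Qed.

Lemma rat_eval_comp g h (tg : transcendental g) (th : transcendental h) f :
  rat_eval tg (rat_eval th f) = rat_subst f (rat_eval tg h).
Proof.
rewrite -[LHS]/((rat_eval tg \o rat_eval th) f) rmorph_rat_subst /=.
  by rewrite rat_evalX.
by move=> c; rewrite !rat_evalC.
Qed.

Lemma rat_subst_ratX f : rat_subst f z = f.
Proof. by rewrite -(@rmorph_rat_subst idfun). Qed.

End RationalFunctions.

(** * Square of a Dunkl-type operator for an abstract dihedral action, indexed by the cyclic group
    ['I_n.+1] *)

Section DihedralDunklSquare.
Variables (L : fieldType) (n : nat) (D : L -> L).
Variables (rho : 'I_n.+1 -> {rmorphism L -> L}) (tau : 'I_n.+1 -> L -> L).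
Variables (A : 'I_n.+1 -> L) (c : L).
Hypothesis DD : {morph D : f g / f + g}.
Hypothesis DM : forall f g, D (f * g) = D f * g + f * D g.
Hypothesis D_rho : forall k f, D (rho k f) = - rho k (D f).
Hypothesis rho_rho : forall k j f, rho k (rho j f) = tau (j - k) f.
Hypothesis tau0 : forall f, tau 0 f = f.
Local Notation S := (\sum_k A k).
Hypothesis rho_sumA : forall k, S + rho k S = - c.
Hypothesis convA : forall m, m != 0 -> \sum_k A k * rho k (A (k + m)) = 0.

Definition dunkl_diff f := \sum_k A k * (rho k f - f).

Lemma dunkl_diffE f : dunkl_diff f = \sum_k A k * rho k f - S * f.
Proof.
rewrite mulr_suml -sumrB; apply: eq_bigr => k _.
by rewrite mulrBr.
Qed.

Lemma dunkl_diffD f g : dunkl_diff (f + g) = dunkl_diff f + dunkl_diff g.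
Proof.
rewrite /dunkl_diff -big_split; apply: eq_bigr => k _ /=.
by rewrite rmorphD; ring.
Qed.

(** After expanding [rho k S] over the indices k + m, [convA] kills every m other than 0. *)
Lemma sum_convA : \sum_k A k * rho k S = \sum_k A k * rho k (A k).
Proof.
transitivity (\sum_m \sum_k A k * rho k (A (k + m))).
  rewrite exchange_big; apply: eq_bigr => k _ /=.
  rewrite -mulr_sumr -rmorph_sum; congr (_ * rho k _).
  by rewrite (reindex_inj (addrI k)).
rewrite (bigD1 0) //= [X in _ + X]big1 => [|m m0]; last exact: convA.
by rewrite addr0; apply: eq_bigr => k _; rewrite addr0.
Qed.

(** The coefficient of [tau m f] in E(E f) is the sum in [convA], so no proper rotation survives;
    the other terms are collected with [rho_sumA]. *)
Lemma dunkl_diff_diff f : dunkl_diff (dunkl_diff f) = c * dunkl_diff f.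
Proof.
have rhoE k : rho k (dunkl_diff f)
    = \sum_m rho k (A (k + m)) * tau m f - rho k S * rho k f.
  rewrite dunkl_diffE rmorphB rmorphM; congr (_ - _).
  rewrite rmorph_sum (reindex_inj (addrI k)) /=; apply: eq_bigr => m _.
  by rewrite rmorphM rho_rho (addrC k m) addrK.
(* The constant [c] is written as [-(S + rho k S)] in the k-th summand, with k varying along the
   sum. *)
have -> : c * dunkl_diff f
    = \sum_k A k * rho k S * (f - rho k f) - S * dunkl_diff f.
  rewrite mulr_sumr mulr_sumr -sumrB; apply: eq_bigr => k _.
  by rewrite -[c]opprK -(rho_sumA k); ring.
rewrite dunkl_diffE; congr (_ - _).
transitivity (\sum_m (\sum_k A k * rho k (A (k + m))) * tau m f
              - \sum_k A k * rho k S * rho k f).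
  have -> : \sum_m (\sum_k A k * rho k (A (k + m))) * tau m f
      = \sum_k A k * \sum_m rho k (A (k + m)) * tau m f.
    under eq_bigr do rewrite mulr_suml.
    rewrite exchange_big; apply: eq_bigr => k _ /=.
    by rewrite mulr_sumr; apply: eq_bigr => m _; rewrite mulrA.
  by rewrite -sumrB; apply: eq_bigr => k _; rewrite rhoE mulrBr mulrA.
rewrite (bigD1 0) //= [X in _ + X - _]big1 ?addr0 => [|m m0]; last first.
  by rewrite convA ?mul0r.
under eq_bigr do rewrite addr0.
rewrite tau0 -sum_convA mulr_suml -sumrB; apply: eq_bigr => k _.
by rewrite mulrBr.
Qed.

Lemma D_sum (F : 'I_n.+1 -> L) : D (\sum_k F k) = \sum_k D (F k).
Proof.
apply: (big_morph D DD); apply: (addrI (D 0)).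
by rewrite -DD !addr0.
Qed.

Lemma D_opp f : D (- f) = - D f.
Proof.
apply/eqP; rewrite -addr_eq0 -DD addNr; apply/eqP; apply: (addrI (D 0)).
by rewrite -DD !addr0.
Qed.

Lemma dunkl_square f :
  D (D f + dunkl_diff f) + dunkl_diff (D f + dunkl_diff f)
    - c * (D f + dunkl_diff f)
  = D (D f) - (2 * S + c) * D f + \sum_k D (A k) * (rho k f - f).
Proof.
(* Since [D] anticommutes with [rho k], the terms [A k * rho k (D f)] of the two products cancel. *)
have DE : D (dunkl_diff f) + dunkl_diff (D f)
    = \sum_k D (A k) * (rho k f - f) - 2 * S * D f.
  rewrite D_sum -big_split -mulrA mulr_suml mulr_sumr -sumrB.
  by apply: eq_bigr => k _ /=; rewrite DM DD D_opp D_rho; ring.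
(* The square of E now cancels against [c * dunkl_diff f]. *)
rewrite dunkl_diffD dunkl_diff_diff DD.
transitivity (D (D f) + (D (dunkl_diff f) + dunkl_diff (D f)) - c * D f).
  by ring.
by rewrite DE; ring.
Qed.

End DihedralDunklSquare.

(** * Sums over roots of unity: powers, fractions and convolutions *)

Section RootOfUnitySums.
Variables (L : fieldType) (n : nat).
Implicit Types c d x : L.

(** If N does not divide i, the sum is geometric with ratio w^i distinct from 1; multiplied by w^i -
    1 it becomes w^(iN) - 1 = 0. *)
Lemma sum_prim_root_expr N (w : L) i : N.-primitive_root w ->
  \sum_(k < N) w ^+ (k * i) = if (N %| i)%N then N%:R else 0.
Proof.
move=> wN; case: ifP => [/dvdnP[e ->]|Ni].
  under eq_bigr => k _.
    rewrite mulnA mulnC exprM (prim_expr_order wN) expr1n.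
    over.
  by rewrite sumr_const card_ord.
have wi1 : w ^+ i - 1 != 0 by rewrite subr_eq0 -(prim_order_dvd wN) Ni.
apply: (mulfI wi1); rewrite mulr0.
under eq_bigr do rewrite mulnC exprM.
by rewrite -subrX1 exprAC (prim_expr_order wN) expr1n subrr.
Qed.

(* Expand each fraction over the common denominator 1 - x^N, and sum over k
   first: only the power x^j survives. *)
Lemma sum_prim_root_fraction N (w : L) j x : N.-primitive_root w ->
  (forall k, w ^+ k - x != 0) -> x ^+ N != 1 -> (0 < j <= N)%N ->
  \sum_(k < N) w ^+ (k * j) * x / (w ^+ k - x) = N%:R * x ^+ j / (1 - x ^+ N).
Proof.
move=> wN wx xN1 /andP[j_gt0 jN].
have xN1' : 1 - x ^+ N != 0 by rewrite subr_eq0 eq_sym.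
have fracE k : w ^+ (k * j) * x / (w ^+ k - x)
    = \sum_(i < N) w ^+ (k * (N - i.+1 + j)) * (x ^+ i.+1 / (1 - x ^+ N)).
  have e : (w ^+ k - x) * (\sum_(i < N) (w ^+ k) ^+ (N - i.+1) * x ^+ i)
      = 1 - x ^+ N.
    rewrite -[1](expr1n _ k) -(prim_expr_order wN) exprAC subrXX.
    congr (_ * _); apply: eq_bigr => i _; congr (_ ^+ _ * _); lia.
  apply: (canLR (mulfK (wx k))); rewrite -[LHS]mulr1.
  rewrite -[X in _ * X = _](divff xN1') -{1}e.
  rewrite mulr_sumr !mulr_suml mulr_sumr; apply: eq_bigr => i _.
  by rewrite mulnDr exprD -exprM [x ^+ i.+1]exprS; ring.
under eq_bigr do rewrite fracE.
rewrite exchange_big /=.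
under eq_bigr do rewrite -mulr_suml (sum_prim_root_expr _ wN).
have jN' : (j.-1 < N)%N by rewrite prednK.
rewrite (bigD1 (Ordinal jN')) //= prednK // subnK // dvdnn big1 => [|i ne_ij].
  by rewrite addr0 mulrA.
(* The exponent lies strictly between 0 and 2N, so a multiple of N must be N itself, which forces i
   + 1 = j. *)
case: ifP => [/dvdnP[e H]|]; last by rewrite mul0r.
move/eqP: ne_ij => []; apply: val_inj => /=.
have := ltn_ord i; case: e H => [|[|e]] H; nia.
Qed.

Lemma sum_telescope (W : 'I_n.+1 -> L) m : \sum_j (W j - W (j - m)) = 0.
Proof.
rewrite sumrB [X in X - _](reindex_inj (addIr (- m))) /=.
by rewrite subrr.
Qed.

(** The sum of A_j R_j(A_(j+m)) for even N, with y = z^2, [s] the sign (-1)^j, and R_j sending y to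
    q_j^2 / y. In y the j-th summand has poles only at q_j and q_(j-m), and its two partial
    fractions telescope. *)
Lemma sum_even_convolution (q s : 'I_n.+1 -> L) y m :
  (forall j k, q (j + k) = q j * q k) -> (forall j k, s (j + k) = s j * s k) ->
  (forall j, s j ^+ 2 = 1) -> (forall j, q j != 0) -> q m != 1 ->
  (forall j, q j - y != 0) -> y != 0 -> forall c d,
  \sum_j (c + s j * d) * (y / (q j - y))
    * ((c + s (j + m) * d) * ((q j ^+ 2 / y) / (q (j + m) - q j ^+ 2 / y))) = 0.
Proof.
move=> qD sD s2 q0 qm1 qy y0 c d.
(* The partial fraction at the pole y = q_j. *)
pose W j := (c + s j * d) * (c + s (j + m) * d) * q j / ((q m - 1) * (q j - y)).
rewrite -[RHS](sum_telescope W m); apply: eq_bigr => j _.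
(* Signs square to 1, so shifts by m and -m agree and [W (j - m)] carries the same two sign factors
   as [W j]. *)
rewrite /W subrK; have -> : s (j + m) = s (j - m).
  by rewrite -{1}[j](subrK m) !sD -mulrA -expr2 s2 mulr1.
have := qy (j - m); have qj : q j = q (j - m) * q m by rewrite -qD subrK.
have qj0 := q0 (j - m); rewrite [q (j + m)]qD (mulrC (c + s (j - m) * d)).
have := qy j; rewrite qj; move: qm1 (q0 m).
rewrite -subr_eq0; move: (q m) (q (j - m)) qj0 => u v v0 u1 u0 uv_y v_y.
(* Factoring the denominator of the reflected term reduces its nonvanishing to that of [v - y]. *)
have vuy : v * u * u * y - (v * u) ^+ 2 = - (v * u ^+ 2 * (v - y)) by ring.
field.
by rewrite vuy v_y u1 uv_y y0 oppr_eq0 !mulf_neq0 // expf_neq0.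
Qed.

(** The analogous sum for odd N, with x = z, h_j^2 = q^j, and R_j sending x to h_j^2 / x. *)
Lemma sum_odd_convolution (h : 'I_n.+1 -> L) x m :
  (forall j k, h (j + k) = h j * h k) -> (forall j, h j != 0) ->
  h m ^+ 2 != 1 -> (forall j, h j ^+ 2 - x ^+ 2 != 0) -> x != 0 -> forall c d,
  \sum_j (c * x ^+ 2 + h j * d * x) / (h j ^+ 2 - x ^+ 2)
    * ((c * (h j ^+ 2 / x) ^+ 2 + h (j + m) * d * (h j ^+ 2 / x))
       / (h (j + m) ^+ 2 - (h j ^+ 2 / x) ^+ 2)) = 0.
Proof.
move=> hD h0 hm1 hx x0 c d.
(* The numerator separates the part odd in x from the even part; each has its own telescoping
   constant. *)
pose W j := (c * d / (h m - 1) * x * h j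
             + (c ^+ 2 + d ^+ 2 * h m) / (h m ^+ 2 - 1) * h j ^+ 2)
            / (h j ^+ 2 - x ^+ 2).
rewrite -[RHS](sum_telescope W m); apply: eq_bigr => j _.
rewrite /W [h (j + m)]hD.
have := hx (j - m); have hj : h j = h (j - m) * h m by rewrite -hD subrK.
have hj0 := h0 (j - m).
have := hx j; rewrite hj; move: hm1 (h0 m).
rewrite -subr_eq0; move: (h m) (h (j - m)) hj0 => u v v0 u1 u0 uv_x v_x.
have u1' : u - 1 != 0.
  by move: u1; rewrite subr_sqr_1 mulf_eq0 negb_or => /andP[].
have vux : (v * u * u * x) ^+ 2 - (v * u) ^+ 2 ^+ 2
    = - (v ^+ 2 * u ^+ 4 * (v ^+ 2 - x ^+ 2)) by ring.
field.
by rewrite vux v_x u1 u1' uv_x x0 oppr_eq0 !mulf_neq0 // expf_neq0.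
Qed.

End RootOfUnitySums.

Lemma prim_root_half (L : fieldType) (w : L) M :
  (M.*2).-primitive_root w -> w ^+ M = -1.
Proof.
move=> wM; have M0 : (0 < M)%N by rewrite -double_gt0 (prim_order_gt0 wM).
have : (w ^+ M) ^+ 2 == 1 by rewrite -exprM muln2 (prim_expr_order wM).
rewrite sqrf_eq1 -(prim_order_dvd wM) => /orP[/dvdn_leq|/eqP //].
by lia.
Qed.

(** * Closed form of S in terms of z^N *)

Section SumIdentities.
Variables (L : fieldType) (N : nat) (c d x w : L).
Hypothesis wN : N.-primitive_root w.
Hypothesis wx : forall k, w ^+ k - x ^+ 2 != 0.
Hypothesis xN1 : (x ^+ N) ^+ 2 != 1.

Let x2N1 : (x ^+ 2) ^+ N != 1. Proof. by rewrite exprAC. Qed.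

(** The case j = N of the fraction sum, where the powers w^(kN) are 1. *)
Let sumN : \sum_(k < N) x ^+ 2 / (w ^+ k - x ^+ 2)
  = N%:R * (x ^+ N) ^+ 2 / (1 - (x ^+ N) ^+ 2).
Proof.
rewrite (exprAC x N) -(sum_prim_root_fraction wN wx x2N1) ?leqnn ?andbT.
  apply: eq_bigr => k _.
  by rewrite mulnC exprM (prim_expr_order wN) expr1n mul1r.
exact: prim_order_gt0 wN.
Qed.

(* (-1)^k = q^(k N/2) is itself a power of q^k. *)
Lemma sum_coefA_even : ~~ odd N ->
  \sum_(k < N) (c + (-1) ^+ k * d) * (x ^+ 2 / (w ^+ k - x ^+ 2))
  = N%:R * (c * (x ^+ N) ^+ 2 + d * x ^+ N) / (1 - (x ^+ N) ^+ 2).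
Proof.
move=> evenN; have NE : N = N./2.*2 by rewrite even_halfK.
have N0 := prim_order_gt0 wN.
have w_half : w ^+ N./2 = -1 by apply: prim_root_half; rewrite -NE.
transitivity (\sum_(k < N) (c * (x ^+ 2 / (w ^+ k - x ^+ 2))
    + d * (w ^+ (k * N./2) * x ^+ 2 / (w ^+ k - x ^+ 2)))).
  by apply: eq_bigr => k _; rewrite mulnC exprM w_half; ring.
rewrite big_split /= -[X in X + _]mulr_sumr -[X in _ + X]mulr_sumr sumN.
rewrite (sum_prim_root_fraction wN wx x2N1); last by lia.
have -> : (x ^+ 2) ^+ N./2 = x ^+ N by rewrite -exprM mul2n -NE.
by rewrite (exprAC x 2); ring.
Qed.

(** The linear term h^k x equals w^(k(N+1)/2) x^2 / x. The fraction sum with j = (N+1)/2 yields x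
    x^N, whose extra factor x cancels. *)
Lemma sum_coefA_odd (h : L) : odd N -> h = w ^+ N.+1./2 -> x != 0 ->
  \sum_(k < N) (c * x ^+ 2 + h ^+ k * d * x) / ((h ^+ k) ^+ 2 - x ^+ 2)
  = N%:R * (c * (x ^+ N) ^+ 2 + d * x ^+ N) / (1 - (x ^+ N) ^+ 2).
Proof.
move=> oddN hE x0; have NE : (N.+1./2 * 2 = N.+1)%N by lia.
have h2 : h ^+ 2 = w by rewrite hE -exprM NE exprS (prim_expr_order wN) mulr1.
transitivity (\sum_(k < N) (c * (x ^+ 2 / (w ^+ k - x ^+ 2))
    + d / x * (w ^+ (k * N.+1./2) * x ^+ 2 / (w ^+ k - x ^+ 2)))).
  apply: eq_bigr => k _; rewrite mulnC exprM -hE exprAC h2.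
  by field; rewrite wx x0.
rewrite big_split /= -[X in X + _]mulr_sumr -[X in _ + X]mulr_sumr sumN.
rewrite (sum_prim_root_fraction wN wx x2N1); last by lia.
have -> : (x ^+ 2) ^+ N.+1./2 = x * x ^+ N by rewrite -exprM mulnC NE exprS.
rewrite (exprAC x 2); field.
by rewrite x0 subr_eq0 eq_sym xN1.
Qed.

End SumIdentities.

(** * Two rational identities in u = z^N *)

Section Identities.
Variable L : fieldType.
Implicit Types (N c d u x : L).

(** Every R_k inverts u because q^N = 1. The [d] terms cancel and the [c] terms add up to a
    constant. *)
Lemma sum_coefA_reflection N c d u : u != 0 -> u ^+ 2 != 1 ->
  N * (c * u ^+ 2 + d * u) / (1 - u ^+ 2)
    + N * (c * u^-1 ^+ 2 + d * u^-1) / (1 - u^-1 ^+ 2) = - (N * c).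
Proof.
move=> u0; rewrite -subr_eq0 => u1.
have u1' : 1 - u ^+ 2 != 0 by rewrite -opprB oppr_eq0.
by field; rewrite u0 u1 u1'.
Qed.

(** Passage from theta to d/dz: [x] is z, while [f] and [f'] are the first and second derivatives of
    the function acted on. *)
Lemma coefC_identity N c d u x f f' : u ^+ 2 != 1 ->
  x * (f + x * f')
    - (2 * (N * (c * u ^+ 2 + d * u) / (1 - u ^+ 2)) + N * c) * (x * f)
  = x ^+ 2 * f' + x * (1 + N * c + 2 * N * (c + d * u) / (u ^+ 2 - 1)) * f.
Proof.
rewrite -subr_eq0 => u1.
have u1' : 1 - u ^+ 2 != 0 by rewrite -opprB oppr_eq0.
by field; rewrite u1 u1'.
Qed.

End Identities.

(** * Primitivity of q *)

Section RootQ.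
Variable R : realType.

Lemma rootqX N k : rootq R N ^+ k
  = cos (k%:R * (2 * pi / N%:R)) +i* sin (k%:R * (2 * pi / N%:R)).
Proof.
elim: k => [|k IH]; first by rewrite mul0r cos0 sin0.
rewrite exprS IH /rootq /cexp /= expR0 mul1r; set t := 2 * pi / _.
have -> : k.+1%:R * t = t + k%:R * t by rewrite mulrS mulrDl mul1r.
rewrite cosD sinD [LHS]/=; simpc; congr (_ +i* _).
by rewrite addrC mulrC [X in _ + X]mulrC.
Qed.

(** An order m < N would put y = m pi / N in (0, pi) with cos(2y) = 1, hence sin y = 0, although
    sine is positive there. *)
Lemma rootq_primitive N : (0 < N)%N -> N.-primitive_root (rootq R N).
Proof.
move=> N0; have N0' : N%:R != 0 :> R by rewrite pnatr_eq0 -lt0n.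
have qN : rootq R N ^+ N = 1.
  by rewrite rootqX mulrC divfK // mulr_natl cos2pi sin2pi.
have [m mq mN] := prim_order_exists N0 qN.
have := dvdn_leq N0 mN; rewrite leq_eqVlt => /orP[/eqP eN|ltmN].
  by rewrite -{1}eN.
have := prim_expr_order mq; rewrite rootqX.
pose y : R := m%:R * (pi / N%:R); have -> : m%:R * (2 * pi / N%:R) = y *+ 2.
  by rewrite /y -mulr_natl; field.
move=> /(congr1 (@complex.Re R)) /=; rewrite cos_mulr2n => cos2y.
have m0 := prim_order_gt0 mq.
have sin_y : 0 < sin y.
  apply: sin_gt0_pi; rewrite !mulr_gt0 ?invr_gt0 ?pi_gt0 ?ltr0n //=.
  by rewrite /y mulrCA gtr_pMr ?pi_gt0 // ltr_pdivrMr ?ltr0n // mul1r ltr_nat.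
have : sin y ^+ 2 = 0.
  by rewrite sin2cos2; move: cos2y; rewrite -[_ *+ 2]mulr_natl; lra.
by move/eqP; rewrite expf_eq0 gt_eqF.
Qed.

End RootQ.

(** * Nonvanishing denominators and the derivative of c / z *)

Section RationalFunctionFacts.
Variable F : fieldType.
Local Notation z := (@ratX F).
Implicit Types (c : F) (n : nat).

Lemma ratX_exprB_neq0 c n : (0 < n)%N -> ratC c - z ^+ n != 0.
Proof.
move=> n0; rewrite /ratC /ratX -tofracXn -tofracB tofrac_eq0.
apply: contraTneq isT => /(congr1 (fun p : {poly F} => p`_n)).
rewrite coefB coefC coefXn eqxx gtn_eqF // sub0r coef0 => /eqP.
by rewrite oppr_eq0 oner_eq0.
Qed.

Lemma rat_der_divX c : z * rat_der (ratC c / z) = - (ratC c / z).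
Proof.
have := rat_derC c; rewrite -{1}[ratC c](divfK (ratX_neq0 F)).
move: (ratC c / z) => f; rewrite rat_derM rat_derX mulr1 mulrC.
by move/eqP; rewrite addr_eq0 => /eqP.
Qed.

End RationalFunctionFacts.

(** * Images of S and A_k under a field morphism fixing their coefficients *)

Section MorphismImages.
Variables (L : fieldType) (phi : {rmorphism L -> L}) (c d e p x y : L).
Hypotheses (phi_c : phi c = c) (phi_d : phi d = d) (phi_e : phi e = e).
Hypotheses (phi_p : phi p = p) (phi_x : phi x = y).

Lemma rmorph_sum_coefA N : phi (N%:R * (c * x ^+ 2 + d * x) / (1 - x ^+ 2))
  = N%:R * (c * y ^+ 2 + d * y) / (1 - y ^+ 2).
Proof.
rewrite fmorph_div rmorphM rmorph_nat rmorphD rmorphB rmorph1 !rmorphM.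
by rewrite phi_c phi_d phi_x.
Qed.

Lemma rmorph_coefA_even : phi ((c + e * d) * (x ^+ 2 / (p - x ^+ 2)))
  = (c + e * d) * (y ^+ 2 / (p - y ^+ 2)).
Proof.
rewrite rmorphM rmorphD rmorphM fmorph_div rmorphB rmorphXn.
by rewrite phi_c phi_d phi_e phi_p phi_x.
Qed.

Lemma rmorph_coefA_odd : phi ((c * x ^+ 2 + e * d * x) / (p - x ^+ 2))
  = (c * y ^+ 2 + e * d * y) / (p - y ^+ 2).
Proof.
rewrite fmorph_div rmorphD rmorphM rmorphB !rmorphM.
by rewrite phi_c phi_d phi_e phi_p phi_x.
Qed.

End MorphismImages.

(** * The coefficients A_k and the reflections R_k *)

Section Operators.
Variables (R : realType) (alpha beta : R) (n : nat).
Local Notation N := n.+1.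
Local Notation K := {fraction {poly R[i]}}.
Local Notation z := (@ratX R[i]).
Local Notation q := (rootq R N).
Local Notation w := (ratC q).
Local Notation c := (ratR (alpha + beta + 1)).
Local Notation d := (ratR (alpha - beta)).
Local Notation h := (ratC (q ^+ N.+1./2)).
Local Notation A := (coefA alpha beta N).

Let qN : N.-primitive_root q. Proof. exact: rootq_primitive. Qed.

Let wN : N.-primitive_root w. Proof. by rewrite fmorph_primitive_root. Qed.

Lemma rootqN : q ^+ N = 1. Proof. exact: prim_expr_order qN. Qed.

Lemma rootq_neq0 : q != 0.
Proof.
apply: contraTneq (oner_neq0 R[i]) => q0; rewrite negbK.
by rewrite -(prim_expr_order qN) q0 expr0n.
Qed.

Lemma rootqX_neq0 k : q ^+ k != 0.
Proof. by rewrite expf_neq0 ?rootq_neq0. Qed.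

Lemma ratC_rootqX k : ratC (q ^+ k) = w ^+ k.
Proof. exact: rmorphXn. Qed.

Lemma coefA_even k : ~~ odd N ->
  coefA alpha beta N k = (c + (-1) ^+ k * d) * (z ^+ 2 / (w ^+ k - z ^+ 2)).
Proof.
rewrite /coefA => /negPf ->; congr (_ * (_ / (_ - _))); last exact: ratC_rootqX.
rewrite /ratR /jacobi_sigma.
have -> : (alpha + beta + 1 + (-1) ^+ k * (alpha - beta))%:C
    = (alpha + beta + 1)%:C + (-1) ^+ k * (alpha - beta)%:C :> R[i].
  by rewrite rmorphD rmorphM rmorphXn rmorphN1.
by rewrite rmorphD rmorphM rmorphXn rmorphN1.
Qed.

(* With h = q^((N+1)/2) one has h^2 = q and h^N = 1, and rho_k = h^k for both
   parities of k. *)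
Lemma jacobi_rhoE k : odd N -> (k < N)%N ->
  jacobi_rho R N k = (q ^+ N.+1./2) ^+ k.
Proof.
move=> oddN ltkN; rewrite /jacobi_rho.
case: ifP => oddk.
  have -> : ((k%:Z - N%:Z) %/ 2)%Z = - ((N - k)./2)%:Z by lia.
  rewrite -exprnN; apply: (mulIf (rootqX_neq0 (N - k)./2)).
  rewrite mulVf ?rootqX_neq0 // -exprM -exprD.
  (* The total exponent is a multiple of N, so the product of the two powers is 1. *)
  have -> : (N.+1./2 * k + (N - k)./2 = N * k.+1./2)%N.
    have [aE bE] : (N.+1./2 = (n./2).+1 /\ N = (n./2).*2.+1)%N by lia.
    have [b1 b2 b3] : [/\ (N - k)./2 = n./2 - k./2, k.+1./2 = k./2.+1
      & k = k./2.*2.+1]%N by split; lia.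
    have : (k./2 <= n./2)%N by lia.
    by rewrite aE b1 b2 [in X in (X + _)%N]b3 bE; nia.
  by rewrite exprM (prim_expr_order qN) expr1n.
have -> : (k%:Z %/ 2)%Z = (k./2)%:Z by lia.
rewrite -exprM -exprnP.
have -> : (N.+1./2 * k = N * k./2 + k./2)%N.
  have [aE bE] : (N.+1./2 = (n./2).+1 /\ N = (n./2).*2.+1)%N by lia.
  have b : k = k./2.*2 by lia.
  by rewrite aE {1}b bE; nia.
by rewrite exprD exprM (prim_expr_order qN) expr1n mul1r.
Qed.

Lemma coefA_odd k : odd N -> (k < N)%N -> coefA alpha beta N k
  = (c * z ^+ 2 + h ^+ k * d * z) / ((h ^+ k) ^+ 2 - z ^+ 2).
Proof.
move=> oddN ltkN; rewrite /coefA oddN jacobi_rhoE // rmorphXn.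
congr (_ / (_ - _)); rewrite -rmorphXn -rmorphXn /=; congr ratC.
rewrite exprAC -(exprM q); have -> : (N.+1./2 * 2 = N.+1)%N by lia.
by rewrite exprS (prim_expr_order qN) mulr1.
Qed.

Lemma rootqX_subX2_neq0 k : w ^+ k - z ^+ 2 != 0.
Proof. by rewrite -ratC_rootqX ratX_exprB_neq0. Qed.

Lemma ratX2N_neq1 : (z ^+ N) ^+ 2 != 1.
Proof.
rewrite -exprM eq_sym -subr_eq0 -[1](rmorph1 (@ratC R[i])).
by apply: ratX_exprB_neq0; lia.
Qed.

Lemma sum_coefA : \sum_(k < N) coefA alpha beta N k
  = N%:R * (c * (z ^+ N) ^+ 2 + d * z ^+ N) / (1 - (z ^+ N) ^+ 2).
Proof.
have [oddN|evenN] := boolP (odd N).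
  rewrite -(sum_coefA_odd c d wN rootqX_subX2_neq0 ratX2N_neq1 oddN
    (ratC_rootqX _) (ratX_neq0 _)).
  by apply: eq_bigr => k _; apply: coefA_odd.
rewrite -(sum_coefA_even c d wN rootqX_subX2_neq0 ratX2N_neq1 evenN).
by apply: eq_bigr => k _; apply: coefA_even.
Qed.

Definition refl k : {rmorphism K -> K} :=
  rat_eval (transcendental_divX (rootqX_neq0 k)).

Lemma reflE k f : refl k f = reflection N k f.
Proof. by []. Qed.

Lemma reflC k a : refl k (ratC a) = ratC a.
Proof. exact: rat_evalC. Qed.

Lemma reflX k : refl k z = w ^+ k / z.
Proof. by rewrite /refl /= rat_evalX ratC_rootqX. Qed.

(** Chain rule; the sign comes from theta(q^k / z) = - q^k / z. *)
Lemma ratX_der_refl k f : z * rat_der (refl k f) = - refl k (z * rat_der f).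
Proof.
rewrite rmorphM reflX -ratC_rootqX /refl /= rat_der_eval mulrCA rat_der_divX.
by rewrite mulrN mulrC.
Qed.

(** Ordinals add modulo N, which does not change powers of an N-th root of unity. *)
Lemma exprordD (L : nzRingType) (u : L) (j k : 'I_N) : u ^+ N = 1 ->
  u ^+ (j + k : 'I_N)%R = u ^+ j * u ^+ k.
Proof. by move=> uN; rewrite /= expr_mod // exprD. Qed.

Lemma refl_refl (k j : 'I_N) f :
  refl k (refl j f) = rat_subst f (ratC (q ^+ (j - k)%R) * z).
Proof.
have -> : ratC (q ^+ (j - k)%R) = ratC (q ^+ j) / ratC (q ^+ k).
  apply: (canRL (mulfK _)); first by rewrite fmorph_eq0 rootqX_neq0.
  by rewrite -rmorphM -(exprordD _ _ rootqN) subrK.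
rewrite /refl /= rat_eval_comp fmorph_div /= rat_evalC rat_evalX invf_div.
by rewrite mulrA mulrAC.
Qed.

Lemma refl_sum_coefA k :
  \sum_(j < N) A j + refl k (\sum_(j < N) A j) = - (N%:R * c).
Proof.
have rho_zN : refl k (z ^+ N) = (z ^+ N)^-1.
  rewrite rmorphXn reflX exprMn exprVn exprAC -ratC_rootqX.
  by rewrite rootqN rmorph1 expr1n mul1r.
rewrite sum_coefA (rmorph_sum_coefA (reflC _ _) (reflC _ _) rho_zN).
have zN0 : z ^+ N != 0 by rewrite expf_neq0 ?ratX_neq0.
by have -> := @sum_coefA_reflection _ N%:R c d (z ^+ N) zN0 ratX2N_neq1.
Qed.

(** Instances of the abstract convolutions: h^j for odd N, and q^j with the sign (-1)^j for even
    N. *)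
Lemma coefA_convolution (m : 'I_N) : m != 0 ->
  \sum_(j < N) A j * refl j (A (j + m)%R) = 0.
Proof.
move=> m0; have m0' : ~~ (N %| m)%N by rewrite gtnNdvd // lt0n.
have z0 := ratX_neq0 (R[i] : fieldType).
have [oddN|evenN] := boolP (odd N).
  have hN : h ^+ N = 1 by rewrite -rmorphXn exprAC rootqN expr1n rmorph1.
  have hX k : (h ^+ k) ^+ 2 = w ^+ k.
    rewrite exprAC; congr (_ ^+ k); rewrite -rmorphXn -(exprM q).
    have -> : (N.+1./2 * 2 = N.+1)%N by lia.
    by rewrite exprS rootqN mulr1.
  rewrite -[RHS](sum_odd_convolution (h := fun j => h ^+ j) (x := z) (m := m)
    _ _ _ _ _ c d); last 5 first.
  - by move=> j k; apply: exprordD.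
  - by move=> j; apply: expf_neq0; rewrite fmorph_eq0 rootqX_neq0.
  - by rewrite hX -ratC_rootqX fmorph_eq1 -(prim_order_dvd qN).
  - by move=> j; rewrite hX rootqX_subX2_neq0.
  - exact: z0.
  apply: eq_bigr => j _; rewrite !coefA_odd //; congr (_ * _).
  have rho_h : refl j (h ^+ (j + m)%R) = h ^+ (j + m)%R.
    by rewrite rmorphXn reflC.
  have rho_h2 : refl j ((h ^+ (j + m)%R) ^+ 2) = (h ^+ (j + m)%R) ^+ 2.
    by rewrite rmorphXn rho_h.
  have rho_z : refl j z = (h ^+ j) ^+ 2 / z by rewrite reflX hX.
  exact: (rmorph_coefA_odd (reflC _ _) (reflC _ _) rho_h rho_h2 rho_z).
rewrite -[RHS](sum_even_convolution (q := fun j => w ^+ j)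
  (s := fun j => (-1) ^+ j) (y := z ^+ 2) (m := m) _ _ _ _ _ _ _
  c d); last 7 first.
- by move=> j k; apply: exprordD; rewrite -rmorphXn rootqN rmorph1.
(* The sign is a character of Z/N because N is even. *)
- by move=> j k; apply: exprordD; rewrite -signr_odd (negPf evenN).
- by move=> j; rewrite sqrr_sign.
- by move=> j; rewrite -ratC_rootqX fmorph_eq0 rootqX_neq0.
- by rewrite -ratC_rootqX fmorph_eq1 -(prim_order_dvd qN).
- by move=> j; rewrite rootqX_subX2_neq0.
- by rewrite expf_neq0.
apply: eq_bigr => j _; rewrite !coefA_even //; congr (_ * _).
have rho_s : refl j ((-1) ^+ (j + m)%R) = (-1) ^+ (j + m)%R.
  by rewrite rmorphXn rmorphN1.
have rho_w : refl j (w ^+ (j + m)%R) = w ^+ (j + m)%R.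
  by rewrite -ratC_rootqX reflC.
rewrite (rmorph_coefA_even (reflC _ _) (reflC _ _) rho_s rho_w (reflX j)).
by rewrite expr_div_n.
Qed.

End Operators.

(** * The two expressions for H(N) *)

Section OperatorIdentity.
Variables (R : realType) (alpha beta : R) (n : nat).
Local Notation N := n.+1.
Local Notation K := {fraction {poly R[i]}}.
Local Notation z := (@ratX R[i]).
Local Notation q := (rootq R N).
Local Notation c := (ratR (alpha + beta + 1)).
Local Notation A := (coefA alpha beta N).
Local Notation theta := (fun f : K => z * rat_der f).
Local Notation E :=
  (dunkl_diff (fun k : 'I_N => refl R n k) (fun k : 'I_N => A k)).

Lemma opLE f : opL alpha beta N f = theta f + E f.
Proof. by rewrite /opL big_mkord. Qed.

Lemma ratR_mul_nat x : ratR (N%:R * x) = N%:R * ratR x :> K.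
Proof.
rewrite /ratR; have -> : (N%:R * x)%:C = N%:R * x%:C.
  by rewrite rmorphM rmorph_nat.
by rewrite rmorphM rmorph_nat.
Qed.

(** [dunkl_square] for theta and the R_k, whose composites are rotations; then theta is rewritten
    through d/dz. *)
Lemma opH_reflectionsE f :
  opH alpha beta N f = opH_reflections alpha beta N f.
Proof.
rewrite /opH !opLE ratR_mul_nat.
rewrite (@dunkl_square _ _ theta (fun k : 'I_N => refl R n k)
  (fun m f => rat_subst f (ratC (q ^+ m) * z)) (fun k : 'I_N => A k)
  (N%:R * c)).
  rewrite /opH_reflections /Defs.coefC ratR_mul_nat big_mkord [in RHS]mulr_sumr.
  congr (_ + _).
    rewrite sum_coefA rat_derM rat_derX mul1r mulnC exprM.
    exact: coefC_identity (ratX2N_neq1 R n).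
  by apply: eq_bigr => k _; apply/esym/mulrA.
- by move=> g1 g2; rewrite rat_derD mulrDr.
- move=> g1 g2; rewrite rat_derM mulrDr.
  by congr (_ + _); [apply: mulrA|apply: mulrCA].
- by move=> k g; apply: ratX_der_refl.
- by move=> k j g; apply: refl_refl.
- by move=> g; rewrite expr0 rmorph1 mul1r rat_subst_ratX.
- by move=> k; apply: refl_sum_coefA.
- by move=> m; apply: coefA_convolution.
Qed.

(** A symmetric f may be replaced by f(1/z), and inverting q^k / z gives q^(-k) z. *)
Lemma reflection_rotation k f : rat_subst f z^-1 = f ->
  reflection N k f = rotation N (- k%:Z) f.
Proof.
move=> sym_f.
have t1 : transcendental (ratC (1 : R[i]) / z).
  by apply: transcendental_divX; rewrite oner_neq0.
have {1}<- : rat_eval t1 f = f by rewrite /rat_eval rmorph1 mul1r.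
rewrite -reflE /refl /= rat_eval_comp /rotation.
rewrite fmorph_div /= rat_evalC rat_evalX rmorph1 div1r invf_div mulrC.
by rewrite -fmorphV exprnN mulrC.
Qed.

Lemma opH_rotationsE f : rat_subst f z^-1 = f ->
  opH_reflections alpha beta N f = opH_rotations alpha beta N f.
Proof.
move=> sym_f; rewrite /opH_reflections /opH_rotations; congr (_ + z * _).
have rot0 : rotation N (- 0%:Z) f = f.
  by rewrite /rotation oppr0 expr0z rmorph1 mul1r rat_subst_ratX.
(* The term k = 0 vanishes, so the sum may start at 1. *)
rewrite big_ltn // (reflection_rotation 0 sym_f) rot0 [f - f]subrr.
rewrite [X in X + _]mulr0 [LHS]add0r.
by apply: eq_bigr => k _; rewrite reflection_rotation.
Qed.

End OperatorIdentity.

(** * Laurent polynomials and the inversion of z *)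

Section Laurent.
Variable F : fieldType.
Local Notation K := {fraction {poly F}}.
Local Notation z := (@ratX F).
Implicit Types f g : K.

Lemma laurentD f g : laurent f -> laurent g -> laurent (f + g).
Proof.
move=> [p [m ->]] [p' [m' ->]]; exists (p * 'X^m' + p' * 'X^m), (m + m')%N.
rewrite addf_div ?expf_neq0 ?ratX_neq0 // exprD.
by rewrite !(tofracD, tofracM, tofracXn).
Qed.

Lemma laurentM f g : laurent f -> laurent g -> laurent (f * g).
Proof.
move=> [p [m ->]] [p' [m' ->]]; exists (p * p'), (m + m')%N.
by rewrite mulf_div exprD tofracM.
Qed.

Lemma laurentC (a : F) : laurent (ratC a).
Proof. by exists a%:P, 0%N; rewrite expr0 divr1. Qed.

Lemma laurentN f : laurent f -> laurent (- f).
Proof.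
by rewrite -mulN1r -(rmorphN1 (@ratC F)); apply: laurentM; apply: laurentC.
Qed.

Lemma laurentX m : laurent (z ^+ m).
Proof. by exists 'X^m, 0%N; rewrite expr0 divr1 tofracXn. Qed.

Lemma laurentV m : laurent (z ^- m).
Proof. by exists 1, m; rewrite tofrac1 div1r. Qed.

Let t1 : transcendental (ratC (1 : F) / z).
Proof. by apply: transcendental_divX; rewrite oner_neq0. Qed.

(** The point 1/z is spelled [ratC 1 / z] to fit [transcendental_divX]. *)
Definition inversion : {rmorphism K -> K} := rat_eval t1.

Lemma inversionE f : inversion f = rat_subst f z^-1.
Proof. by rewrite /inversion /= /rat_eval rmorph1 div1r. Qed.

Lemma inversionX : inversion z = z^-1.
Proof. by rewrite /inversion /= rat_evalX rmorph1 div1r. Qed.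

Lemma inversionC a : inversion (ratC a) = ratC a.
Proof. exact: rat_evalC. Qed.

Lemma inversionK : involutive inversion.
Proof.
have inv_g : inversion (ratC 1 / z) = z.
  by rewrite fmorph_div inversionX inversionC rmorph1 invrK mul1r.
move=> f; apply: (etrans (rat_eval_comp t1 t1 f)).
by rewrite [X in rat_subst f X]inv_g rat_subst_ratX.
Qed.

Lemma laurent_inversion f : laurent f -> laurent (inversion f).
Proof.
move=> [p [m ->]]; rewrite fmorph_div rmorphXn inversionX exprVn invrK.
apply: laurentM; last exact: laurentX.
elim/poly_ind: p => [|p a IH].
  by rewrite tofrac0 rmorph0 -(rmorph0 (@ratC F)); apply: laurentC.
rewrite tofracD tofracM rmorphD rmorphM inversionX (inversionC a).
by apply: laurentD (laurentC a); apply: laurentM IH (laurentV 1).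
Qed.

End Laurent.

(** * Symmetry of the sieved Jacobi polynomials *)

Lemma verblunsky_step (L : fieldType) (a f g u x : L) : x != 0 -> u != 0 ->
  x * u * (x^-1 * g - a * (x * u ^+ 2)^-1 * f) + (1 + a) * (u^-1 * f)
  = u * g + u^-1 * f.
Proof. by move=> x0 u0; field; rewrite x0 u0. Qed.

Section SievedJacobi.
Variables (R : realType) (alpha beta : R) (N : nat).
Local Notation z := (@ratX R[i]).
Local Notation Phi := (sieved_Phi alpha beta N).
Local Notation inv := (@inversion R[i]).

Lemma sieved_Phi_laurent n : laurent (Phi n).
Proof.
elim: n => [|n IH] /=; first by rewrite -(rmorph1 (@ratC _)); apply: laurentC.
rewrite -inversionE; apply: laurentD; first exact: (laurentM (laurentX _ 1)).
apply/laurentN/laurentM; last exact: laurent_inversion.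
by apply: laurentM; [apply: laurentC | apply: laurentX].
Qed.

(** One recurrence step eliminates Phi_(2n+2), and the Verblunsky coefficient cancels. Inversion of
    z exchanges the two remaining terms, which makes the symmetry visible. *)
Lemma sieved_jacobiE n : sieved_jacobi alpha beta N n.+1
  = z ^+ n * inv (Phi (2 * n).+1%N) + z ^- n * Phi (2 * n).+1%N.
Proof.
have -> : sieved_jacobi alpha beta N n.+1 = sieved_psi alpha beta N (2 * n).+2
    + (1 + ratR (sieved_verblunsky alpha beta N (2 * n).+1))
      * sieved_psi alpha beta N (2 * n).+1.
  by rewrite /sieved_jacobi mulnS.
have psi_odd : sieved_psi alpha beta N (2 * n).+1 = z ^- n * Phi (2 * n).+1.
  by rewrite /sieved_psi (_ : odd _ = true) 1?(_ : _./2 = n) //; lia.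
have psi_even : sieved_psi alpha beta N (2 * n).+2
    = z ^+ n.+1 * inv (Phi (2 * n).+2).
  rewrite /sieved_psi (_ : odd _ = false) 1?(_ : _./2 = n.+1) ?inversionE //;
  by lia.
rewrite psi_odd psi_even; set a := sieved_verblunsky _ _ _ _.
have -> : Phi (2 * n).+2
    = z * Phi (2 * n).+1 - ratR a * z ^+ (2 * n).+1 * inv (Phi (2 * n).+1).
  by rewrite inversionE.
move: (Phi (2 * n).+1) => f.
have -> : inv (z * f - ratR a * z ^+ (2 * n).+1 * inv f)
    = z^-1 * inv f - ratR a * (z * (z ^+ n) ^+ 2)^-1 * f.
  rewrite rmorphB; congr (_ - _); first by rewrite rmorphM inversionX.
  rewrite [LHS]rmorphM inversionK; congr (_ * _).
  rewrite [LHS]rmorphM inversionC rmorphXn inversionX; congr (_ * _).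
  by rewrite exprVn exprS mulnC exprM.
(* Here x = z, u = z^n, f = Phi_(2n+1), and g is the inversion of f. *)
rewrite exprS; apply: verblunsky_step (ratX_neq0 _) _.
by rewrite expf_neq0 ?ratX_neq0.
Qed.

Lemma sieved_jacobi_symmetric n :
  symmetric_laurent (sieved_jacobi alpha beta N n).
Proof.
case: n => [|n].
  split; last by rewrite -inversionE; apply: rmorph1.
  by rewrite /= -(rmorph1 (@ratC _)); apply: laurentC.
rewrite sieved_jacobiE; have lPhi := sieved_Phi_laurent (2 * n).+1.
split.
  apply: laurentD; apply: laurentM => //;
    [exact: laurentX|exact: laurent_inversion|exact: laurentV].
move: (Phi _) lPhi => f _; rewrite -inversionE [LHS]rmorphD [RHS]addrC.
have inv_zn : inv (z ^+ n) = z ^- n by rewrite rmorphXn inversionX exprVn.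
congr (_ + _); first by rewrite [LHS]rmorphM inversionK inv_zn.
by rewrite [LHS]rmorphM -inv_zn inversionK.
Qed.

End SievedJacobi.

Theorem theorem6p2 (R : realType) (N : nat) (alpha beta : R)
  (N_ge1 : (1 <= N)%N)
  (a_lt1 : forall n : nat, `|verblunsky alpha beta n| < 1) :
  [/\ forall f : {fraction {poly R[i]}}, laurent f ->
        opH alpha beta N f = opH_reflections alpha beta N f,
      forall f : {fraction {poly R[i]}}, symmetric_laurent f ->
        opH alpha beta N f = opH_rotations alpha beta N f
        /\ opH_reflections alpha beta N f = opH_rotations alpha beta N f
    & forall n : nat, symmetric_laurent (sieved_jacobi alpha beta N n)
        /\ opH alpha beta N (sieved_jacobi alpha beta N n)
             = opH_reflections alpha beta N (sieved_jacobi alpha beta N n)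
        /\ opH alpha beta N (sieved_jacobi alpha beta N n)
             = opH_rotations alpha beta N (sieved_jacobi alpha beta N n) ].
Proof.
(* Writing N as n + 1 makes the index set a cyclic group. *)
case: N N_ge1 => // n _; split=> [f _|f [_ sym_f]|k].
- exact: opH_reflectionsE.
- by rewrite opH_reflectionsE; split=> //; apply: opH_rotationsE.
have sym_P := sieved_jacobi_symmetric alpha beta n.+1 k.
split=> //; rewrite opH_reflectionsE; split=> //.
by case: sym_P => _; apply: opH_rotationsE.
Qed.
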